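(* For $n\ge0$ the Jones--Wenzl projections of type $D$ satisfy $$Q_{n+1}=Q_n\left(\sum_{i=1}^{n+2}\mathrm{coef}(g_{n+1,i})\,g_{n+1,i}+\sum_{j=0}^{n+1}\mathrm{coef}(h_{n+1,j})\,h_{n+1,j}\right),$$ where, for $1\le i\le n+1$ and $0\le j\le n$, $$\mathrm{coef}(g_{n,i})=\begin{cases}\dfrac{[n]}{[2n]},& i=1,\\[6pt] \dfrac{[n][2i-2]}{[2n][i-1]},&\text{otherwise},\end{cases}\qquad \mathrm{coef}(h_{n,j})=\frac{[n][n+1-j]}{[2n][n+1]}.$$
   Context: Work over $\mathbb{C}(q)$ with $[m]=(q^m-q^{-m})/(q-q^{-1})$. $\mathrm{TL}^D_{n+1}$ is the unital algebra generated by $E_0,\dots,E_n$ with relations $E_i^2=-[2]E_i$; $E_iE_jE_i=E_i$ if $i,j$ are adjacent; $E_iE_j=E_jE_i$ if $i\neq j$ are not adjacent, where adjacency is in the graph on $\{0,\dots,n\}$ with edges $\{0,2\},\{1,2\}$ and $\{i,i+1\}$ for $2\le i\le n-1$. For $m\le n$, $\mathrm{TL}^D_{m+1}$ is the subalgebra generated by $E_0,\dots,E_m$. $Q_n\in\mathrm{TL}^D_{n+1}$ ($n\ge 0$) is the unique element with $Q_n\ne0$, $Q_nQ_i=Q_iQ_n=Q_n$ for $0\le i\le n$, and $E_iQ_n=Q_nE_i=0$ for $0\le i\le n$; in particular $Q_0=1+\frac1{[2]}E_0$. For $n\ge1$ define elements of $\mathrm{TL}^D_{n+1}$ by $g_{n,n+1}=1$,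 $g_{n,i}=E_nE_{n-1}\cdots E_i$ for $1\le i\le n$, $h_{n,0}=E_nE_{n-1}\cdots E_2E_0$, and $h_{n,j}=E_nE_{n-1}\cdots E_2E_0E_1E_2\cdots E_j$ for $1\le j\le n$ (so for $n=1$, where $E_n\cdots E_2$ is the empty product, $h_{1,0}=E_0$ and $h_{1,1}=E_0E_1$). *)

(* Defs.v *)
From HB Require Import structures.
From mathcomp Require Import all_boot all_order all_algebra.
From mathcomp Require Import boolp reals complex.

Set Implicit Arguments.
Unset Strict Implicit.
Unset Printing Implicit Defensive.

Import GRing.Theory.
Local Open Scope ring_scope.

(* Unital associative algebras given by generators and relations: formal      *)
(* expressions modulo the least congruence containing the axioms of unital    *)
(* F-algebras and the relations. The quotient is only a pzRingType and an     *)
(* lmodType, since relations may force 1 = 0; peval is the universal property.*)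
Inductive term (F I : Type) : Type :=
| TConst of F
| TGen of I
| TAdd of term F I & term F I
| TMul of term F I & term F I.
Arguments TConst {F I}.
Arguments TGen {F I}.

HB.instance Definition _ (F I : Type) := gen_eqMixin (term F I).
HB.instance Definition _ (F I : Type) := gen_choiceMixin (term F I).

Section Presentation.
Variables (F : fieldType) (I : Type) (r : term F I -> term F I -> Prop).
Implicit Types (t u v : term F I) (a b : F).

Inductive cong : term F I -> term F I -> Prop :=
| cong_rel t u : r t u -> cong t u
| cong_refl t : cong t t
| cong_sym t u : cong t u -> cong u t
| cong_trans u t v : cong t u -> cong u v -> cong t v
| cong_add t t' u u' : cong t t' -> cong u u' -> cong (TAdd t u) (TAdd t' u')
| cong_mul t t' u u' : cong t t' -> cong u u' -> cong (TMul t u) (TMul t' u')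
| cong_addA t u v : cong (TAdd t (TAdd u v)) (TAdd (TAdd t u) v)
| cong_addC t u : cong (TAdd t u) (TAdd u t)
| cong_add0 t : cong (TAdd (TConst 0) t) t
| cong_addN t : cong (TAdd (TMul (TConst (-1)) t) t) (TConst 0)
| cong_mulA t u v : cong (TMul t (TMul u v)) (TMul (TMul t u) v)
| cong_mul1l t : cong (TMul (TConst 1) t) t
| cong_mul1r t : cong (TMul t (TConst 1)) t
| cong_mulDl t u v : cong (TMul (TAdd t u) v) (TAdd (TMul t v) (TMul u v))
| cong_mulDr t u v : cong (TMul t (TAdd u v)) (TAdd (TMul t u) (TMul t v))
| cong_constD a b : cong (TConst (a + b)) (TAdd (TConst a) (TConst b))
| cong_constM a b : cong (TConst (a * b)) (TMul (TConst a) (TConst b))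
| cong_constC a t : cong (TMul (TConst a) t) (TMul t (TConst a)).

Local Notation "t ~~~ u" := (cong t u) (at level 70).

Definition congb t u : bool := `[< t ~~~ u >].

Lemma congb_refl : reflexive congb.
Proof. by move=> t; apply/asboolP; exact: cong_refl. Qed.

Lemma congb_sym : symmetric congb.
Proof. by move=> t u; apply/asboolP/asboolP; exact: cong_sym. Qed.

Lemma congb_trans : transitive congb.
Proof.
by move=> u t v /asboolP tu /asboolP uv; apply/asboolP; exact: cong_trans uv.
Qed.

Canonical cong_equiv := EquivRel congb congb_refl congb_sym congb_trans.

Definition presAlg : Type := {eq_quot cong_equiv}%qT.
HB.instance Definition _ := Choice.on presAlg.
HB.instance Definition _ := EqQuotient.on presAlg.

Definition pclass t : presAlg := \pi_presAlg%qT t.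

Lemma pclassP t u : pclass t = pclass u <-> t ~~~ u.
Proof.
split=> [/eqmodP /asboolP //|tu].
by apply/eqmodP/asboolP.
Qed.

Lemma pclass_repr (x : presAlg) : pclass (repr x) = x.
Proof. exact: reprK. Qed.

Lemma pclass_ind (P : presAlg -> Prop) : (forall t, P (pclass t)) -> forall x, P x.
Proof. by move=> Pt x; rewrite -[x]pclass_repr. Qed.

Lemma repr_pclass t : repr (pclass t) ~~~ t.
Proof. by apply/pclassP; rewrite pclass_repr. Qed.

Definition padd (x y : presAlg) := pclass (TAdd (repr x) (repr y)).
Definition pmul (x y : presAlg) := pclass (TMul (repr x) (repr y)).
Definition popp (x : presAlg) := pclass (TMul (TConst (-1)) (repr x)).
Definition pscale a (x : presAlg) := pclass (TMul (TConst a) (repr x)).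

Lemma paddE t u : padd (pclass t) (pclass u) = pclass (TAdd t u).
Proof. by apply/pclassP; apply: cong_add; exact: repr_pclass. Qed.

Lemma pmulE t u : pmul (pclass t) (pclass u) = pclass (TMul t u).
Proof. by apply/pclassP; apply: cong_mul; exact: repr_pclass. Qed.

Lemma poppE t : popp (pclass t) = pclass (TMul (TConst (-1)) t).
Proof.
by apply/pclassP; apply: cong_mul; [exact: cong_refl | exact: repr_pclass].
Qed.

Lemma pscaleE a t : pscale a (pclass t) = pclass (TMul (TConst a) t).
Proof.
by apply/pclassP; apply: cong_mul; [exact: cong_refl | exact: repr_pclass].
Qed.

Let pE := (paddE, pmulE, poppE, pscaleE).

Lemma paddA : associative padd.
Proof.
elim/pclass_ind=> t; elim/pclass_ind=> u; elim/pclass_ind=> v; rewrite !pE.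
exact/pclassP/cong_addA.
Qed.

Lemma paddC : commutative padd.
Proof.
elim/pclass_ind=> t; elim/pclass_ind=> u; rewrite !pE.
exact/pclassP/cong_addC.
Qed.

Lemma padd0 : left_id (pclass (TConst 0)) padd.
Proof. by elim/pclass_ind=> t; rewrite !pE; exact/pclassP/cong_add0. Qed.

Lemma paddN : left_inverse (pclass (TConst 0)) popp padd.
Proof. by elim/pclass_ind=> t; rewrite !pE; exact/pclassP/cong_addN. Qed.

HB.instance Definition _ := GRing.isZmodule.Build presAlg paddA paddC padd0 paddN.

Lemma pmulA : associative pmul.
Proof.
elim/pclass_ind=> t; elim/pclass_ind=> u; elim/pclass_ind=> v; rewrite !pE.
exact/pclassP/cong_mulA.
Qed.

Lemma pmul1l : left_id (pclass (TConst 1)) pmul.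
Proof. by elim/pclass_ind=> t; rewrite !pE; exact/pclassP/cong_mul1l. Qed.

Lemma pmul1r : right_id (pclass (TConst 1)) pmul.
Proof. by elim/pclass_ind=> t; rewrite !pE; exact/pclassP/cong_mul1r. Qed.

Lemma pmulDl : left_distributive pmul padd.
Proof.
elim/pclass_ind=> t; elim/pclass_ind=> u; elim/pclass_ind=> v; rewrite !pE.
exact/pclassP/cong_mulDl.
Qed.

Lemma pmulDr : right_distributive pmul padd.
Proof.
elim/pclass_ind=> t; elim/pclass_ind=> u; elim/pclass_ind=> v; rewrite !pE.
exact/pclassP/cong_mulDr.
Qed.

HB.instance Definition _ :=
  GRing.Zmodule_isPzRing.Build presAlg pmulA pmul1l pmul1r pmulDl pmulDr.

Lemma pscaleA a b x : pscale a (pscale b x) = pscale (a * b) x.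
Proof.
elim/pclass_ind: x => t; rewrite !pE; apply/pclassP.
apply: cong_trans (cong_mulA _ _ _) _.
apply: cong_mul (cong_refl _); exact/cong_sym/cong_constM.
Qed.

Lemma pscale1 : left_id 1 pscale.
Proof. by elim/pclass_ind=> t; rewrite !pE; exact/pclassP/cong_mul1l. Qed.

Lemma pscaleDr : right_distributive pscale +%R.
Proof.
move=> a; elim/pclass_ind=> t; elim/pclass_ind=> u.
by rewrite /GRing.add/= !pE; exact/pclassP/cong_mulDr.
Qed.

Lemma pscaleDl x : {morph pscale^~ x : a b / a + b}.
Proof.
elim/pclass_ind: x => t a b; rewrite {2}/GRing.add/= !pE; apply/pclassP.
apply: cong_trans (cong_mulDl _ _ _).
apply: cong_mul (cong_refl _); exact: cong_constD.
Qed.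

HB.instance Definition _ := GRing.Zmodule_isLmodule.Build F presAlg
  pscaleA pscale1 pscaleDr pscaleDl.

Lemma pscaleAl a (x y : presAlg) : a *: (x * y) = a *: x * y.
Proof.
elim/pclass_ind: x => t; elim/pclass_ind: y => u.
rewrite /GRing.scale/= /GRing.mul/= !pE.
exact/pclassP/cong_mulA.
Qed.

Lemma pscaleAr a (x y : presAlg) : a *: (x * y) = x * (a *: y).
Proof.
elim/pclass_ind: x => t; elim/pclass_ind: y => u.
rewrite /GRing.scale/= /GRing.mul/= !pE; apply/pclassP.
apply: cong_trans (cong_mulA _ _ _) _.
apply: cong_trans (cong_sym (cong_mulA _ _ _)).
apply: cong_mul (cong_refl _); exact: cong_constC.
Qed.

Definition pgen (i : I) : presAlg := pclass (TGen i).

Lemma pclass_const a : pclass (TConst a) = a *: (1 : presAlg).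
Proof.
by rewrite /GRing.scale/= /GRing.one/= pE; exact/pclassP/cong_sym/cong_mul1r.
Qed.

Lemma pclass_add t u : pclass (TAdd t u) = pclass t + pclass u.
Proof. by rewrite -paddE. Qed.

Lemma pclass_mul t u : pclass (TMul t u) = pclass t * pclass u.
Proof. by rewrite -pmulE. Qed.

Section UniversalProperty.
Variables (A : algType F) (e : I -> A).

Fixpoint teval t : A :=
  match t with
  | TConst a => a%:A
  | TGen i => e i
  | TAdd t u => teval t + teval u
  | TMul t u => teval t * teval u
  end.

Definition respects := forall t u, r t u -> teval t = teval u.

Hypothesis hr : respects.

Lemma teval_cong t u : t ~~~ u -> teval t = teval u.
Proof.
elim=> //= {t u}.
- by move=> t u v _ -> _ ->.
- by move=> t t' u u' _ -> _ ->.
- by move=> t t' u u' _ -> _ ->.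
- by move=> t u v; rewrite addrA.
- by move=> t u; rewrite addrC.
- by move=> t; rewrite scale0r add0r.
- by move=> t; rewrite scaleN1r mulN1r addNr scale0r.
- by move=> t u v; rewrite mulrA.
- by move=> t; rewrite scale1r mul1r.
- by move=> t; rewrite scale1r mulr1.
- by move=> t u v; rewrite mulrDl.
- by move=> t u v; rewrite mulrDr.
- by move=> a b; rewrite scalerDl.
- by move=> a b; rewrite -scalerAl mul1r scalerA.
- by move=> a t; rewrite -scalerAl mul1r -scalerAr mulr1.
Qed.

Definition peval of respects := fun x : presAlg => teval (repr x).

Local Notation pev := (peval hr).

Lemma peval_class t : pev (pclass t) = teval t.
Proof. exact/teval_cong/repr_pclass. Qed.

Lemma peval_gen i : pev (pgen i) = e i.
Proof. exact: peval_class. Qed.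

Lemma pevalD x y : pev (x + y) = pev x + pev y.
Proof.
by elim/pclass_ind: x => t; elim/pclass_ind: y => u; rewrite -pclass_add !peval_class.
Qed.

Lemma pevalM x y : pev (x * y) = pev x * pev y.
Proof.
by elim/pclass_ind: x => t; elim/pclass_ind: y => u; rewrite -pclass_mul !peval_class.
Qed.

Lemma peval1 : pev 1 = 1.
Proof. by rewrite -[1 in LHS]scale1r -pclass_const peval_class /= scale1r. Qed.

Lemma pevalZ a x : pev (a *: x) = a *: pev x.
Proof.
rewrite -[x in LHS]mul1r pscaleAl -pclass_const pevalM peval_class /=.
by rewrite -scalerAl mul1r.
Qed.

Lemma peval0 : pev 0 = 0.
Proof. by rewrite -[0 in LHS](scale0r (0 : presAlg)) pevalZ scale0r. Qed.

End UniversalProperty.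

End Presentation.

(* TLD q n is the algebra usually written TL^D_{n+1}: it has n + 1 generators. *)
Section TLD.
Variables (F : fieldType) (q : F).

Definition qint (m : nat) : F := (q ^+ m - q ^- m) / (q - q^-1).

Definition edgeD (i j : nat) : bool :=
  [|| (i == 0) && (j == 2), (i == 1) && (j == 2) | (2 <= i) && (j == i.+1)]%N.

Definition adjD (i j : nat) : bool := edgeD i j || edgeD j i.

Inductive TLD_rel (n : nat) : term F 'I_n.+1 -> term F 'I_n.+1 -> Prop :=
| TLD_sq (i : 'I_n.+1) :
    TLD_rel (TMul (TGen i) (TGen i)) (TMul (TConst (- qint 2)) (TGen i))
| TLD_adj (i j : 'I_n.+1) : adjD i j ->
    TLD_rel (TMul (TMul (TGen i) (TGen j)) (TGen i)) (TGen i)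
| TLD_comm (i j : 'I_n.+1) : i != j -> ~~ adjD i j ->
    TLD_rel (TMul (TGen i) (TGen j)) (TMul (TGen j) (TGen i)).

Definition TLD (n : nat) : Type := presAlg (@TLD_rel n).

HB.instance Definition _ n := GRing.PzRing.on (TLD n).
HB.instance Definition _ n := GRing.Lmodule.on (TLD n).

(* The augmentation E_i |-> 0 shows that TLD n is not the zero ring. *)
Lemma TLD_aug_respects n : respects (@TLD_rel n) (fun=> 0 : F^o).
Proof.
move=> t u [i|i j _|i j _ _] /=; by rewrite ?(mulr0, mul0r).
Qed.

Definition TLD_aug n : TLD n -> F^o := peval (@TLD_aug_respects n).

Lemma TLD_oner_neq0 n : (1 : TLD n) != 0.
Proof.
apply/eqP => /(congr1 (@TLD_aug n)); rewrite /TLD_aug peval1 peval0.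
by apply/eqP; rewrite oner_eq0.
Qed.

HB.instance Definition _ n :=
  GRing.PzSemiRing_isNonZero.Build (TLD n) (@TLD_oner_neq0 n).
HB.instance Definition _ n :=
  GRing.LSemiModule_isLSemiAlgebra.Build F (TLD n) (@pscaleAl _ _ (@TLD_rel n)).
HB.instance Definition _ n :=
  GRing.LSemiAlgebra_isSemiAlgebra.Build F (TLD n) (@pscaleAr _ _ (@TLD_rel n)).

Definition TLD_gen n (i : 'I_n.+1) : TLD n := pgen (@TLD_rel n) i.

Lemma TLD_genS n (i : 'I_n.+1) :
  TLD_gen i * TLD_gen i = - qint 2 *: TLD_gen i.
Proof.
rewrite -pclass_mul; have /cong_rel/pclassP -> := TLD_sq i.
by rewrite pclass_mul pclass_const -pscaleAl mul1r.
Qed.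

Lemma TLD_gen_adj n (i j : 'I_n.+1) : adjD i j ->
  TLD_gen i * TLD_gen j * TLD_gen i = TLD_gen i.
Proof. by move=> /TLD_adj/cong_rel/pclassP; rewrite !pclass_mul. Qed.

Lemma TLD_gen_comm n (i j : 'I_n.+1) : i != j -> ~~ adjD i j ->
  TLD_gen i * TLD_gen j = TLD_gen j * TLD_gen i.
Proof.
by move=> ij adjij; have /cong_rel/pclassP := TLD_comm ij adjij; rewrite !pclass_mul.
Qed.

Lemma TLD_incl_respects m n (le_mn : (m <= n)%N) :
  respects (@TLD_rel m) (fun i => TLD_gen (widen_ord (le_mn : m < n.+1)%N i)).
Proof.
move=> t u [i|i j ij|i j nij ij] /=.
- by rewrite TLD_genS -scalerAl mul1r.
- exact: TLD_gen_adj.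
- exact: TLD_gen_comm.
Qed.

(* The map realising TL^D_{m+1} as the subalgebra of TL^D_{n+1} generated by  *)
(* E_0, ..., E_m.                                                             *)
Definition TLD_incl m n (le_mn : (m <= n)%N) : TLD m -> TLD n :=
  peval (TLD_incl_respects le_mn).

Section Incl.
Variables (m n : nat) (le_mn : (m <= n)%N).

Lemma TLD_incl_zmod_morphism : zmod_morphism (TLD_incl le_mn).
Proof.
by move=> x y; rewrite -scaleN1r /TLD_incl pevalD pevalZ scaleN1r.
Qed.

Lemma TLD_incl_monoid_morphism : monoid_morphism (TLD_incl le_mn).
Proof. by split=> [|x y]; [exact: peval1 | exact: pevalM]. Qed.

Lemma TLD_incl_scalable : scalable (TLD_incl le_mn).
Proof. by move=> a x; exact: pevalZ. Qed.

HB.instance Definition _ := GRing.isZmodMorphism.Build (TLD m) (TLD n)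
  (TLD_incl le_mn) TLD_incl_zmod_morphism.
HB.instance Definition _ := GRing.isMonoidMorphism.Build (TLD m) (TLD n)
  (TLD_incl le_mn) TLD_incl_monoid_morphism.
HB.instance Definition _ := GRing.isScalable.Build F (TLD m) (TLD n) *:%R
  (TLD_incl le_mn) TLD_incl_scalable.

Lemma TLD_incl_gen (i : 'I_m.+1) :
  TLD_incl le_mn (TLD_gen i) = TLD_gen (widen_ord (le_mn : m < n.+1)%N i).
Proof. exact: peval_gen. Qed.

End Incl.

(* The properties characterising Q_n involve all the Q_i with i <= n, so they *)
(* are stated for the whole family; Q_i is viewed in TL^D_{n+1}.              *)
Definition JonesWenzlD (Q : forall n, TLD n) : Prop :=
  forall n : nat,
  [/\ Q n != 0,
      forall (i : nat) (le_in : (i <= n)%N),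
        Q n * TLD_incl le_in (Q i) = Q n /\ TLD_incl le_in (Q i) * Q n = Q n
    & forall i : 'I_n.+1, TLD_gen i * Q n = 0 /\ Q n * TLD_gen i = 0].

(* TLD_E n i is only meaningful for i <= n. *)
Definition TLD_E (n i : nat) : TLD n := TLD_gen (inord i).

(* E_n E_{n-1} ... E_i, equal to 1 if i = n + 1 *)
Definition TLD_g (n i : nat) : TLD n := \prod_(k <- rev (index_iota i n.+1)) TLD_E n k.

(* E_n ... E_2 E_0 E_1 ... E_j *)
Definition TLD_h (n j : nat) : TLD n := TLD_g n 2 * TLD_E n 0 * \prod_(1 <= k < j.+1) TLD_E n k.

Definition coef_g (n i : nat) : F :=
  if i == 1%N then qint n / qint (2 * n)
  else (qint n * qint (2 * i - 2)) / (qint (2 * n) * qint (i - 1)).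

Definition coef_h (n j : nat) : F :=
  (qint n * qint (n + 1 - j)) / (qint (2 * n) * qint (n + 1)).

End TLD.

(* C is R[i] for a realType R, and qvar is the indeterminate of C(q). *)
Definition Cq (R : realType) : fieldType := {fraction {poly R[i]}}.
Definition qvar (R : realType) : Cq R := tofrac ('X : {poly R[i]}).

(* Main.v *)
Require Import Defs.
From mathcomp Require Import all_boot all_order all_algebra.
From mathcomp Require Import reals complex.
From mathcomp Require Import fraction zify ring.

Import GRing.Theory.
Local Open Scope ring_scope.

(** The element P = Q_n X, with X the bracketed sum of g's and h's and
    N = n + 1, is annihilated on the right by every E_k with k <= N.  Granting
    this, P = Q_N follows without any uniqueness or spanning theorem:
    - an element killed on the right by all generators sees any y through a
      scalar only (the augmentation of y), and that scalar is 1 for y = Q_N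
      because Q_N is a nonzero idempotent; so P Q_N = P
      ([TLD_scalar_action]);
    - every word of X other than g_{N,N+1} = 1, which has coefficient 1, ends
      in a generator, so X Q_N = Q_N and P Q_N = Q_n Q_N = Q_N.

    The annihilation uses only that x = Q_n satisfies x E_k = 0 for k < N.
    The elements x g_i and x h_j then span a right module on which E_k acts
    sparsely.  Picture the words as the chain

        g_{N+1} - g_N - ... - g_2 <  g_1 , h_0  > h_1 - h_2 - ... - h_N

    in which two branches g_1 and h_0 join g_2 to h_1.  Right multiplication
    by E_k multiplies the words that end in E_k by -[2] (h_1 = E_N...E_2 E_0 E_1
    counts as ending in both E_0 and E_1).  It sends any other word either to an
    adjacent word of the chain that ends in E_k or, modulo x, to 0, since then a
    generator E_l with l < N can be moved to the far left ([killed_g_below] and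
    its companions).  Hence x X E_k = 0 follows from a discrete harmonicity of
    the coefficients: for a word w that ends in E_k, the coefficients of the
    neighbours of w that do not end in E_k add up to [2] times that of w.

    With c = [N]/[2N], the coefficient of g_{i+1} is c (q^i + q^-i) for i > 0.
    The value 2c of this formula at i = 0 is shared equally by the two branches
    g_1 and h_0.  The coefficient of h_j is proportional to [N+1-j] and would
    vanish at j = N + 1, beyond the end of the chain.  Both q^m + q^-m and [m]
    solve u_{m-1} + u_{m+1} = [2] u_m, which is the harmonicity along the chain. *)

(** * Quantum integers at a generic parameter *)

Section Quantum.
Variables (F : fieldType) (q : F).
Hypothesis q_neq0 : q != 0.
Hypothesis q_generic : forall m, (0 < m)%N -> q ^+ m != 1.

Lemma subr_expV_neq0 m : (0 < m)%N -> q ^+ m - q ^- m != 0.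
Proof.
move=> m0; rewrite subr_eq0; apply/eqP => h.
have /eqP [] := q_generic (m + m) ltac:(lia).
by rewrite exprD {1}h mulVf // expf_neq0.
Qed.

Lemma qint_neq0 m : (0 < m)%N -> qint q m != 0.
Proof.
move=> m0; rewrite /qint mulf_neq0 ?invr_eq0 ?subr_expV_neq0 //.
exact: (@subr_expV_neq0 1).
Qed.

Lemma qint0 : qint q 0 = 0.
Proof. by rewrite /qint expr0 invr1 subrr mul0r. Qed.

Lemma qint2E : qint q 2 = q + q^-1.
Proof.
have := subr_expV_neq0 1 isT; rewrite expr1 => h.
by rewrite /qint -exprVn subr_sqr mulrAC divff ?mul1r.
Qed.

Lemma qint_rec m : qint q m + qint q m.+2 = qint q 2 * qint q m.+1.
Proof.
have hm : q ^+ m != 0 by rewrite expf_neq0.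
rewrite qint2E /qint -!mulrDl mulrA; congr (_ / _).
by rewrite !exprS; field; rewrite ?q_neq0 ?hm.
Qed.

Lemma qint_double m : qint q (2 * m) = qint q m * (q ^+ m + q ^- m).
Proof.
have hm : q ^+ m != 0 by rewrite expf_neq0.
by rewrite /qint mulrAC; congr (_ / _); rewrite mul2n -addnn exprD; field.
Qed.

End Quantum.

(** * Right multiplication of the words by a generator *)

(** The relations are stated behind an arbitrary left factor, which makes them
    usable as rewrite rules on left-associated products. *)
Section Words.
Variables (F : fieldType) (q : F) (N : nat).
Local Notation E := (TLD_E q N).
Local Notation G := (TLD_g q N).
Local Notation H := (TLD_h q N).
Implicit Type y : TLD q N.

Lemma mulr_E_sq y i : y * E i * E i = - qint q 2 *: (y * E i).
Proof. by rewrite -mulrA [E i * E i]TLD_genS scalerAr. Qed.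

Lemma mulr_E_adj y i j :
  (i <= N)%N -> (j <= N)%N -> adjD i j -> y * E i * E j * E i = y * E i.
Proof.
move=> iN jN ij; rewrite -(mulrA y) -(mulrA y).
by rewrite [E i * E j * E i]TLD_gen_adj // !inordK.
Qed.

Lemma mulr_E_comm y i j :
  (i <= N)%N -> (j <= N)%N -> i != j -> ~~ adjD i j ->
  y * E i * E j = y * E j * E i.
Proof.
move=> iN jN ij nij; rewrite -!(mulrA y).
by rewrite [E i * E j]TLD_gen_comm // -?val_eqE /= !inordK.
Qed.

Lemma mulr_E_far y i j :
  (i.+1 < j)%N -> (2 < j)%N -> (j <= N)%N -> y * E i * E j = y * E j * E i.
Proof. by move=> ij j2 jN; apply: mulr_E_comm; rewrite /adjD /edgeD; lia. Qed.

Lemma mulr_E01 y : (0 < N)%N -> y * E 0%N * E 1%N = y * E 1%N * E 0%N.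
Proof. by move=> N0; apply: mulr_E_comm. Qed.

Lemma mulr_gS y i : (i <= N)%N -> y * G i = y * G i.+1 * E i.
Proof.
move=> iN; rewrite -mulrA; congr (_ * _).
rewrite /TLD_g /index_iota subSn //= rev_cons -cats1 big_cat big_seq1.
by rewrite subSS.
Qed.

Lemma mulr_g_top y : y * G N.+1 = y.
Proof. by rewrite /TLD_g /index_iota subnn big_nil mulr1. Qed.

Lemma mulr_h0 y : y * H 0%N = y * G 2 * E 0%N.
Proof. by rewrite /TLD_h big_geq // mulr1 mulrA. Qed.

Lemma mulr_hS y j : y * H j.+1 = y * H j * E j.+1.
Proof. by rewrite /TLD_h big_nat_recr //= !mulrA. Qed.

Lemma mulr_g_self y i : (i <= N)%N -> y * G i * E i = - qint q 2 *: (y * G i).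
Proof. by move=> iN; rewrite mulr_gS // mulr_E_sq. Qed.

Lemma mulr_g_succ y i : (0 < i < N)%N -> y * G i * E i.+1 = y * G i.+1.
Proof.
move=> /andP[i0 iN]; have iN' := ltnW iN.
by rewrite mulr_gS // mulr_gS // mulr_E_adj // /adjD /edgeD; lia.
Qed.

Lemma mulr_g1_E0 y : (0 < N)%N -> y * G 1 * E 0%N = y * H 1.
Proof. by move=> N0; rewrite mulr_gS // mulr_hS mulr_h0 mulr_E01. Qed.

Lemma mulr_h0_E2 y : (1 < N)%N -> y * H 0%N * E 2 = y * G 2.
Proof. by move=> N1; rewrite mulr_h0 mulr_gS // mulr_E_adj. Qed.

Lemma mulr_h_self y j : y * H j * E j = - qint q 2 *: (y * H j).
Proof. by case: j => [|j]; rewrite ?mulr_h0 ?mulr_hS mulr_E_sq. Qed.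

Lemma mulr_h_pred y j : (0 < j < N)%N -> y * H j.+1 * E j = y * H j.
Proof.
case: j => // j /= jN; have jN' := ltnW jN.
by rewrite mulr_hS mulr_hS mulr_E_adj // /adjD /edgeD; lia.
Qed.

Lemma mulr_h1_E0 y : (0 < N)%N -> y * H 1 * E 0%N = - qint q 2 *: (y * H 1).
Proof. by move=> N0; rewrite mulr_hS -mulr_E01 // mulr_h_self -scalerAl. Qed.

Lemma mulr_h2_E0 y : (1 < N)%N -> y * H 2 * E 0%N = y * H 1.
Proof.
move=> N1; have N0 := ltnW N1; rewrite mulr_hS mulr_hS mulr_h0.
by rewrite mulr_E01 // mulr_E_adj // -mulr_E01.
Qed.

Variable x : TLD q N.
(* x stands for Q_n, with N = n + 1. *)
Hypothesis xE0 : forall k, (k < N)%N -> x * E k = 0.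

(** E_k commutes with all of g_i = E_N...E_i and so reaches x.  The bound 2 < i
    excludes E_0 next to E_2. *)
Lemma killed_g_below i k :
  (k.+1 < i)%N -> (2 < i)%N -> (i <= N.+1)%N -> x * G i * E k = 0.
Proof.
move=> ki i2 iN; have [d iE] : exists d, i = (N.+1 - d)%N by exists (N.+1 - i)%N; lia.
elim: d i iE ki i2 iN => [|d IH] i iE ki i2 iN.
  by rewrite iE subn0 mulr_g_top xE0 //; lia.
have [iN'|iN'] := leqP i N; last by rewrite (_ : i = N.+1) ?mulr_g_top ?xE0 //; lia.
by rewrite mulr_gS // -mulr_E_far // IH ?mul0r //; lia.
Qed.

(** In g_i E_k the factor E_k travels left to E_k E_(k-1) E_k = E_k, which
    leaves g_k E_(k-2)...E_i; there E_(k-2) commutes with g_k and reaches x. *)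
Lemma killed_g_above i k :
  (0 < i)%N -> (i.+1 < k)%N -> (k <= N)%N -> x * G i * E k = 0.
Proof.
move=> i0 ik kN; have [d iE] : exists d, i = (k - d.+2)%N by exists (k - i.+2)%N; lia.
elim: d i iE i0 ik => [|d IH] i iE i0 ik.
  have kE : k = i.+2 by lia.
  rewrite kE in kN *; rewrite mulr_gS; last lia.
  rewrite (mulr_E_far _ i); try lia.
  rewrite mulr_g_succ; last lia.
  by rewrite killed_g_below //; lia.
rewrite mulr_gS; last lia.
rewrite (mulr_E_far _ i); try lia.
by rewrite IH ?mul0r //; lia.
Qed.

(** E_k commutes with the letters E_j, ..., E_1, and what remains is h_0 E_k =
    g_2 E_k E_0, which falls under the previous two lemmas. *)
Lemma killed_h_above j k :
  (j.+1 < k)%N -> (2 < k)%N -> (k <= N)%N -> x * H j * E k = 0.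
Proof.
move=> jk k2 kN; elim: j jk => [|j IH] jk; last first.
  by rewrite mulr_hS mulr_E_far ?IH ?mul0r //; lia.
rewrite mulr_h0 mulr_E_far //.
have [k3|k3] := ltnP 3 k; first by rewrite killed_g_above ?mul0r.
have kE : k = 3 by lia.
by rewrite kE in kN *; rewrite mulr_g_succ // killed_g_below //; lia.
Qed.

(** E_k travels left until it meets E_(k+1) (E_2 if k = 0).  The relation
    E_k E_(k+1) E_k = E_k then shortens the word to h_k (h_1 if k = 0) followed
    by E_(k+2) (E_3 if k = 0), which is killed by [killed_h_above]. *)
Lemma killed_h_below j k :
  (k.+1 < j)%N -> (2 < j)%N -> (j <= N)%N -> x * H j * E k = 0.
Proof.
elim: j => // j IH kj j2 jN; rewrite mulr_hS -mulr_E_far //.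
have [j3|j3] := ltnP 2 j; have [kj'|kj'] := ltnP k.+1 j.
- by rewrite IH ?mul0r //; lia.
- have jE : j = k.+1 by lia.
  by rewrite jE in j3 jN *; rewrite mulr_h_pred ?killed_h_above //; lia.
- have [jE kE] : j = 2 /\ k = 0%N by lia.
  by rewrite jE kE in jN *; rewrite mulr_h2_E0 ?killed_h_above //; lia.
have [jE kE] : j = 2 /\ k = 1%N by lia.
by rewrite jE kE in jN *; rewrite mulr_h_pred ?killed_h_above //; lia.
Qed.

End Words.

(** * Harmonicity of the coefficients *)

Section Coefficients.
Variables (F : fieldType) (q : F).
Hypothesis q_neq0 : q != 0.
Hypothesis q_generic : forall m, (0 < m)%N -> q ^+ m != 1.
Variable N : nat.
Hypothesis N_gt0 : (0 < N)%N.
Local Notation a := (coef_g q N).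
Local Notation b := (coef_h q N).
Local Notation c := (qint q N / qint q (2 * N)).

Lemma coef_gE i : (0 < i)%N -> a i.+1 = c * (q ^+ i + q ^- i).
Proof.
move=> i0; have hi : qint q i != 0 by exact: qint_neq0.
have hN : qint q (2 * N) != 0 by apply: qint_neq0 => //; lia.
rewrite /coef_g ifF; last lia.
rewrite (_ : 2 * i.+1 - 2 = 2 * i)%N; last lia.
have hq : q ^+ i != 0 by rewrite expf_neq0.
rewrite subn1 /= qint_double //; field.
by rewrite hq hN hi.
Qed.

Lemma coef_hE j : b j = c / qint q N.+1 * qint q (N.+1 - j).
Proof. by rewrite /coef_h addn1 invfM; ring. Qed.

Lemma coef_g_top : a N.+1 = 1.
Proof.
rewrite coef_gE // mulrAC -qint_double // divff //.
by apply: qint_neq0 => //; lia.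
Qed.

Lemma coef_g2 : a 2 = qint q 2 * a 1%N.
Proof. by rewrite coef_gE // qint2E // mulrC. Qed.

Lemma coef_g_rec i : (0 < i)%N -> a i.+1 + a i.+3 = qint q 2 * a i.+2.
Proof.
move=> i0; have hi : q ^+ i != 0 by rewrite expf_neq0.
rewrite !coef_gE // -mulrDr mulrCA qint2E //; congr (_ * _).
by rewrite !exprS; field; rewrite q_neq0 hi.
Qed.

Lemma coef_h0 : b 0%N = a 1%N.
Proof. by rewrite coef_hE subn0 divfK // qint_neq0. Qed.

(** The zero coefficient at j = N + 1 lets the sum over h_j be extended by one
    term, so that h_N has two neighbours like the other words. *)
Lemma coef_h_top : b N.+1 = 0.
Proof. by rewrite coef_hE subnn qint0 mulr0. Qed.

(** At g_2 the chain forks, and g_2 has three neighbours. *)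
Lemma coef_g_branch : a 1%N + b 0%N + a 3 = qint q 2 * a 2.
Proof.
rewrite coef_h0 (coef_gE 1) // (coef_gE 2) // /coef_g /= mulrCA -mulr2n.
rewrite -[X in X *+ 2]mulr1 -mulrnAr -mulrDr qint2E //; congr (_ * _).
by field.
Qed.

Lemma coef_h_rec j : (j < N)%N -> b j + b j.+2 = qint q 2 * b j.+1.
Proof.
move=> jN; rewrite !coef_hE [RHS]mulrCA -mulrDr addrC; congr (_ * _).
have [d ->] : exists d, N = (j + d.+1)%N by exists (N - j.+1)%N; lia.
rewrite (_ : _ - j.+2 = d)%N; last lia.
rewrite (_ : _ - j.+1 = d.+1)%N; last lia.
by rewrite (_ : _ - j = d.+2)%N; [apply: qint_rec|lia].
Qed.

End Coefficients.

(** * The expansion is killed by every generator *)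

Lemma sum_window (V : nmodType) (f : nat -> V) m n k l :
  (m <= k)%N -> (k + l <= n)%N ->
  (forall i, (m <= i < n)%N -> ~~ (k <= i < k + l)%N -> f i = 0) ->
  \sum_(m <= i < n) f i = \sum_(i <- iota k l) f i.
Proof.
move=> mk kn f0.
rewrite (big_cat_nat mk); last lia.
rewrite (big_cat_nat (leq_addr l k) kn) /=.
rewrite big_nat_cond big1 ?add0r; last by move=> i /andP[hi _]; apply: f0; lia.
rewrite [X in _ + X]big_nat_cond [X in _ + X]big1 ?addr0; last first.
  by move=> i /andP[hi _]; apply: f0; lia.
by rewrite /index_iota addKn.
Qed.

Section Expansion.
Variables (F : fieldType) (q : F).
Hypothesis q_neq0 : q != 0.
Hypothesis q_generic : forall m, (0 < m)%N -> q ^+ m != 1.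
Variable N : nat.
Hypothesis N_gt0 : (0 < N)%N.
Variable x : TLD q N.
Local Notation E := (TLD_E q N).
Local Notation G := (TLD_g q N).
Local Notation H := (TLD_h q N).
Local Notation a := (coef_g q N).
Local Notation b := (coef_h q N).
Hypothesis xE0 : forall k, (k < N)%N -> x * E k = 0.

(** The window is the set of words that survive right multiplication by E_k; the
    alternatives are the ranges of [killed_h_below] and [killed_h_above]. *)
Lemma sum_h_window k l m : (k <= N)%N -> (m + l <= N.+2)%N ->
  (forall j, ~~ (m <= j < m + l)%N -> (k.+1 < j)%N && (2 < j)%N
        || (j.+1 < k)%N && (2 < k)%N) ->
  (\sum_(0 <= j < N.+1) b j *: (x * H j)) * E k =
  \sum_(j <- iota m l) b j *: (x * H j * E k).
Proof.
move=> kN mlN far.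
transitivity (\sum_(0 <= j < N.+2) b j *: (x * H j * E k)).
  rewrite [RHS]big_nat_recr //= coef_h_top scale0r addr0 mulr_suml.
  by apply: eq_bigr => j _; rewrite -scalerAl.
apply: sum_window => // j /andP[_ jN] /far /orP[] /andP[jk k2].
  have [->|{}jN] : j = N.+1 \/ (j <= N)%N by lia.
    by rewrite coef_h_top scale0r.
  by rewrite killed_h_below ?scaler0.
by rewrite killed_h_above ?scaler0.
Qed.

Lemma sum_g_window k l m : (k <= N)%N -> (0 < m)%N -> (m + l <= N.+2)%N ->
  (forall i, (0 < i)%N -> ~~ (m <= i < m + l)%N -> (k.+1 < i)%N && (2 < i)%N
        || (i.+1 < k)%N) ->
  (\sum_(1 <= i < N.+2) a i *: (x * G i)) * E k =
  \sum_(i <- iota m l) a i *: (x * G i * E k).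
Proof.
move=> kN m0 mlN far; rewrite mulr_suml.
under eq_bigr do rewrite -scalerAl.
apply: sum_window => // i /andP[i0 iN] /(far _ i0) /orP[/andP[ki i2]|ik].
  by rewrite killed_g_below ?scaler0.
by rewrite killed_g_above ?scaler0.
Qed.

(** For j = N the product need not reduce to h_N, but its coefficient is 0. *)
Lemma coef_mulr_h_pred j : (0 < j <= N)%N ->
  b j.+1 *: (x * H j.+1 * E j) = b j.+1 *: (x * H j).
Proof.
move=> /andP[j0 jN]; have [->|{}jN] : j = N \/ (j < N)%N by lia.
  by rewrite coef_h_top !scale0r.
by rewrite mulr_h_pred // j0.
Qed.

Lemma coef_mulr_h2_E0 : b 2 *: (x * H 2 * E 0%N) = b 2 *: (x * H 1).
Proof.
have [NE|N1] : N = 1%N \/ (1 < N)%N by lia.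
  have -> : 2%N = N.+1 by rewrite NE.
  by rewrite coef_h_top !scale0r.
by rewrite mulr_h2_E0.
Qed.

Let SE k := (\sum_(1 <= i < N.+2) a i *: (x * G i)
   + \sum_(0 <= j < N.+1) b j *: (x * H j)) * E k.

Lemma h_window_eq0 k : (1 < k <= N)%N ->
  \sum_(j <- iota k.-1 3) b j *: (x * H j * E k) = 0.
Proof.
case: k => // k /andP[k0 kN] /=; rewrite !big_cons big_nil addr0.
rewrite -mulr_hS mulr_h_self coef_mulr_h_pred; last lia.
rewrite scalerA -!scalerDl addrCA coef_h_rec // [b _ * _]mulrC mulNr addrC.
by rewrite subrr scale0r.
Qed.

Lemma expansion_mul_E_ge3 k : (2 < k <= N)%N -> SE k = 0.
Proof.
move=> /andP[k2 kN]; rewrite /SE mulrDl.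
rewrite (sum_h_window _ 3 k.-1) ?h_window_eq0; try lia.
rewrite addr0 (sum_g_window _ 3 k.-1); try lia.
case: k k2 kN => [|[|k]] //= k2 kN; rewrite !big_cons big_nil addr0.
rewrite mulr_g_succ // mulr_g_self // -mulr_gS // scalerA -!scalerDl.
by rewrite addrCA coef_g_rec // [a _ * _]mulrC mulNr addrC subrr scale0r.
Qed.

Lemma expansion_mul_E2 : (1 < N)%N -> SE 2 = 0.
Proof.
move=> N1; rewrite /SE mulrDl.
rewrite (sum_h_window _ 4 0); try lia.
rewrite (sum_g_window _ 3 1); try lia.
have -> : \sum_(j <- iota 0 4) b j *: (x * H j * E 2) = b 0%N *: (x * G 2).
  by rewrite big_cons mulr_h0_E2 // (h_window_eq0 2) ?addr0.
rewrite /= !big_cons big_nil addr0.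
rewrite mulr_g_succ // mulr_g_self // -mulr_gS // scalerA.
rewrite -!scalerDl (_ : _ + _ = 0) ?scale0r //.
by rewrite mulrN [a 2 * _]mulrC -coef_g_branch //; ring.
Qed.

Lemma expansion_mul_E1 : SE 1 = 0.
Proof.
rewrite /SE mulrDl (sum_h_window _ 3 0); try lia.
rewrite (sum_g_window _ 2 1); try lia.
rewrite /= !big_cons !big_nil !addr0.
rewrite mulr_g_self // -mulr_gS // -mulr_hS mulr_h_self coef_mulr_h_pred //.
rewrite coef_g2 // !scalerA -!scalerDl addrCA coef_h_rec //.
by rewrite !mulrN ![_ * qint q 2]mulrC !addNr !scale0r addr0.
Qed.

Lemma expansion_mul_E0 : SE 0 = 0.
Proof.
rewrite /SE mulrDl (sum_h_window _ 3 0); try lia.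
rewrite (sum_g_window _ 2 1); try lia.
rewrite /= !big_cons !big_nil !addr0.
rewrite mulr_g1_E0 // -mulr_h0 mulr_h_self mulr_h1_E0 // coef_mulr_h2_E0.
(* The terms in x h_0 cancel; those in x h_1 have weights b_0, -[2] b_1, b_2. *)
rewrite coef_g2 // -coef_h0 // addrC !scalerA -addrA addrCA.
rewrite [X in _ + X = _]addrCA -!scalerDl addrA -scalerDl addrAC -addrA coef_h_rec //.
by rewrite !mulrN ![_ * qint q 2]mulrC !addNr !scale0r addr0.
Qed.

Lemma expansion_mul_E k : (k <= N)%N -> SE k = 0.
Proof.
case: k => [|[|[|k]]] kN; first exact: expansion_mul_E0.
- exact: expansion_mul_E1.
- exact: expansion_mul_E2.
by apply: expansion_mul_E_ge3; rewrite kN.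
Qed.

End Expansion.

(** * Comparison with the Jones-Wenzl projection *)

Section ScalarAction.
Variables (F : fieldType) (q : F) (n : nat).

(** The scalar is the augmentation of y, the value at E_i = 0. *)
Lemma TLD_scalar_action (y : TLD q n) : exists c : F,
  forall z : TLD q n, (forall i, z * TLD_gen q i = 0) -> z * y = c *: z.
Proof.
elim/pclass_ind: y; elim=> [c|i|t [c IHc] u [d IHd]|t [c IHc] u [d IHd]].
- by exists c => z _; rewrite pclass_const -scalerAr mulr1.
- by exists 0 => z /(_ i); rewrite scale0r.
- by exists (c + d) => z hz; rewrite pclass_add mulrDr IHc // IHd // scalerDl.
exists (c * d) => z hz.
by rewrite pclass_mul mulrA IHc // -scalerAl IHd // scalerA.
Qed.

Lemma TLD_incl_id (le_nn : (n <= n)%N) (y : TLD q n) : TLD_incl le_nn y = y.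
Proof.
elim/pclass_ind: y; elim=> [c|i|t IHt u IHu|t IHt u IHu].
- by rewrite pclass_const linearZ rmorph1.
- rewrite [LHS]TLD_incl_gen; congr (TLD_gen q _); exact: val_inj.
- by rewrite pclass_add [LHS]pevalD; congr (_ + _).
by rewrite pclass_mul [LHS]pevalM; congr (_ * _).
Qed.

Lemma TLD_g_mul_killed (z : TLD q n) i : (forall k, TLD_gen q k * z = 0) ->
  (i <= n)%N -> TLD_g q n i * z = 0.
Proof.
move=> hz iN; rewrite -[TLD_g _ _ _]mul1r mulr_gS // -mulrA.
by rewrite [TLD_E _ _ _ * z]hz mulr0.
Qed.

Lemma TLD_h_mul_killed (z : TLD q n) j : (forall k, TLD_gen q k * z = 0) ->
  TLD_h q n j * z = 0.
Proof.
move=> hz; rewrite -[TLD_h _ _ _]mul1r.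
by case: j => [|j]; rewrite ?mulr_h0 ?mulr_hS -mulrA [TLD_E _ _ _ * z]hz mulr0.
Qed.

End ScalarAction.

Section Recursion.
Variables (F : fieldType) (q : F).
Hypothesis q_neq0 : q != 0.
Hypothesis q_generic : forall m, (0 < m)%N -> q ^+ m != 1.
Variables (Q : forall n : nat, TLD q n) (hQ : JonesWenzlD Q) (n : nat).

Let X := \sum_(1 <= i < n.+3) coef_g q n.+1 i *: TLD_g q n.+1 i
     + \sum_(0 <= j < n.+2) coef_h q n.+1 j *: TLD_h q n.+1 j.
Let Qn := TLD_incl (leqnSn n) (Q n).

Lemma Qn_mul_E k : (k < n.+1)%N -> Qn * TLD_E q n.+1 k = 0.
Proof.
move=> kn; have [_ _ /(_ (Ordinal kn)) [_ hk]] := hQ n.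
have kE : widen_ord (leqnSn n : n < n.+2)%N (Ordinal kn) = inord k.
  by apply/val_inj; rewrite /= inordK // ltnW.
rewrite /TLD_E -kE -[TLD_gen q _]TLD_incl_gen.
by rewrite -[LHS](pevalM (TLD_incl_respects (q := q) (leqnSn n))) hk peval0.
Qed.

Lemma QnX_mul_gen (i : 'I_n.+2) : Qn * X * TLD_gen q i = 0.
Proof.
have -> : TLD_gen q i = TLD_E q n.+1 i by rewrite /TLD_E inord_val.
rewrite /X mulrDr !mulr_sumr.
under eq_bigr do rewrite -scalerAr.
under [X in _ + X]eq_bigr do rewrite -scalerAr.
by apply: expansion_mul_E => //; [exact: Qn_mul_E | rewrite -ltnS].
Qed.

Lemma X_mul_Q : X * Q n.+1 = Q n.+1.
Proof.
have [_ _ hk] := hQ n.+1.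
have hl k : TLD_gen q k * Q n.+1 = 0 by have [] := hk k.
rewrite /X mulrDl !mulr_suml [X in _ + X]big1 ?addr0; last first.
  by move=> j _; rewrite -scalerAl TLD_h_mul_killed // scaler0.
rewrite big_nat_recr //= big_nat_cond big1 ?add0r; last first.
  by move=> i /andP[/andP[_ iN] _]; rewrite -scalerAl TLD_g_mul_killed // scaler0.
by rewrite coef_g_top // scale1r -[TLD_g _ _ _]mul1r mulr_g_top mul1r.
Qed.

(** The product Q_n X Q_(n+1) is Q_n X because Q_n X kills the generators, and
    Q_n Q_(n+1) = Q_(n+1) because Q_(n+1) does. *)
Lemma JonesWenzlD_recursion : Q n.+1 = Qn * X.
Proof.
have [Q0 Qabs hk] := hQ n.+1.
have [c hc] := TLD_scalar_action _ _ _ (Q n.+1).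
(* Q_(n+1) is a nonzero idempotent, and its square is also c Q_(n+1). *)
have c1 : c = 1.
  apply/eqP; rewrite -subr_eq0; apply: contraNT Q0 => c1.
  have [+ _] := Qabs n.+1 (leqnn _); rewrite TLD_incl_id.
  rewrite hc => [QQ|i]; last by have [] := hk i.
  by rewrite -[Q n.+1](scalerK c1) scalerBl scale1r QQ subrr scaler0.
have := hc _ QnX_mul_gen; rewrite c1 scale1r -mulrA X_mul_Q => <-.
by have [_ ->] := Qabs n (leqnSn n).
Qed.

End Recursion.

(** * The indeterminate is generic *)

Lemma qvar_neq0 (R : realType) : qvar R != 0.
Proof. by rewrite /qvar tofrac_eq0 polyX_eq0. Qed.

Lemma qvar_generic (R : realType) m : (0 < m)%N -> qvar R ^+ m != 1.
Proof.
move=> m0; rewrite /qvar -tofracXn -tofrac1 tofrac_eq.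
apply/eqP => /(congr1 (fun p : {poly R[i]} => size p)).
by rewrite size_polyXn size_poly1; case: m m0.
Qed.

Theorem proposition3p3 (R : realType)
    (Q : forall n : nat, TLD (qvar R) n) (hQ : JonesWenzlD Q) (n : nat) :
  Q n.+1 =
    TLD_incl (leqnSn n) (Q n) *
    (\sum_(1 <= i < n.+3) coef_g (qvar R) n.+1 i *: TLD_g (qvar R) n.+1 i
     + \sum_(0 <= j < n.+2) coef_h (qvar R) n.+1 j *: TLD_h (qvar R) n.+1 j).
Proof.
exact: (JonesWenzlD_recursion _ _ (qvar_neq0 R) (qvar_generic R)).
Qed.
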